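(* Let $k$ be an infinite field, and fix an integer $d>1$. Then there exists an $N$ such that for any $n\ge N$ and any positive integer $r$, there is an ideal $I$ generated by $r$ forms of degree $d$ in $R=k[x_1,\dots,x_n]$ such that $R/I$ has the Hilbert series conjectured by Fröberg up to degree $2d-1$; that is, for every $0\le i\le 2d-1$, $\dim_k (R/I)_i$ equals the coefficient of $t^i$ in $\left[\frac{(1-t^d)^r}{(1-t)^n}\right]$.
   Context: $R=k[x_1,\dots,x_n]$ is the standard graded polynomial ring and $R_i$ denotes its degree $i$ part; a form of degree $d$ is an element of $R_d$. For a power series $\sum_i a_i t^i$ with integer coefficients, $\left[\sum_i a_it^i\right]$ denotes its truncation at the first non-positive coefficient, i.e. $\sum_i b_it^i$ where $b_i=a_i$ if $a_0,\dots,a_i>0$ and $b_i=0$ otherwise. The Hilbert series conjectured by Fröberg for an ideal generated by $r$ generic forms of degree $d$ in $n$ variables is $\left[\frac{(1-t^d)^r}{(1-t)^n}\right]$. *)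

(* Defs.v *)
From HB Require Import structures.
From mathcomp Require Import all_boot all_order all_algebra.
From mathcomp Require Export generic_quotient ring_quotient.
From mathcomp.multinomials Require Export mpoly.
From Stdlib Require Import Classical ClassicalEpsilon.

Set Implicit Arguments.
Unset Strict Implicit.
Unset Printing Implicit Defensive.

Import GRing.Theory.
Local Open Scope ring_scope.
Local Open Scope quotient_scope.

Definition infinite_field (k : fieldType) : Prop :=
  forall s : seq k, exists x, x \notin s.

(* The quotient space V / U; ring_quotient supplies its additive group. *)
Section QuotientSpace.

Variables (K : fieldType) (V : vectType K) (U : {vspace V}).

Definition quotv : Type := Quotient.quot (pred_of_vspace U).
HB.instance Definition _ := GRing.Zmodule.on quotv.

Definition quotv_pi (v : V) : quotv := \pi_(Quotient.quot (pred_of_vspace U)) v.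

Lemma quotv_piB (u v : V) : quotv_pi (u - v) = quotv_pi u - quotv_pi v.
Proof. exact: (raddfB (\pi_(Quotient.quot (pred_of_vspace U)))). Qed.

Lemma quotv_piD (u v : V) : quotv_pi (u + v) = quotv_pi u + quotv_pi v.
Proof. exact: (raddfD (\pi_(Quotient.quot (pred_of_vspace U)))). Qed.

Lemma quotv_piP (u v : V) : quotv_pi u = quotv_pi v <-> u - v \in U.
Proof.
have E := Quotient.idealrBE (pred_of_vspace U) u v.
split=> [h|h].
  by have : (u - v) \in pred_of_vspace U by rewrite E; apply/eqP.
by apply/eqP; rewrite /quotv_pi -E.
Qed.

Definition quotv_scale (a : K) (x : quotv) : quotv := quotv_pi (a *: repr x).

Lemma quotv_reprK (x : quotv) : quotv_pi (repr x) = x.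
Proof. exact: reprK. Qed.

Lemma quotv_scaleE a v : quotv_scale a (quotv_pi v) = quotv_pi (a *: v).
Proof.
apply/quotv_piP; rewrite -scalerBr memvZ //.
by apply/quotv_piP; rewrite quotv_reprK.
Qed.

Fact quotv_scaleA a b x :
  quotv_scale a (quotv_scale b x) = quotv_scale (a * b) x.
Proof. by rewrite -(quotv_reprK x) !quotv_scaleE scalerA. Qed.
Fact quotv_scale1 : left_id 1 quotv_scale.
Proof. by move=> x; rewrite -(quotv_reprK x) quotv_scaleE scale1r. Qed.
Fact quotv_scaleDr : right_distributive quotv_scale +%R.
Proof.
move=> a x y; rewrite -(quotv_reprK x) -(quotv_reprK y).
by rewrite -quotv_piD !quotv_scaleE scalerDr quotv_piD.
Qed.
Fact quotv_scaleDl x : {morph quotv_scale^~ x : a b / a + b}.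
Proof.
move=> a b; rewrite -(quotv_reprK x) !quotv_scaleE scalerDl.
exact: quotv_piD.
Qed.

HB.instance Definition _ := GRing.Zmodule_isLmodule.Build K quotv
  quotv_scaleA quotv_scale1 quotv_scaleDr quotv_scaleDl.

Lemma quotv_piZ a v : quotv_pi (a *: v) = a *: quotv_pi v.
Proof. by rewrite -quotv_scaleE. Qed.

Lemma quotv_pi_is_linear : linear quotv_pi.
Proof. by move=> a u v; rewrite quotv_piD quotv_piZ. Qed.

Let W := (U^C)%VS.
Let dWU : (W :&: U = 0)%VS. Proof. by rewrite capvC capv_compl. Qed.

Let coords (v : V) : 'rV[K]_(\dim W) :=
  \row_i coord (vbasis W) i (daddv_pi W U v).

Let coords_linear : linear coords.
Proof. by move=> a u v; apply/rowP=> i; rewrite !mxE !linearP. Qed.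

Let piW_eq0 v : v \in U -> daddv_pi W U v = 0.
Proof.
move=> vU; have dUW : (U :&: W = 0)%VS by rewrite capvC.
have := daddv_pi_add dWU (subvP (addvSr W U) v vU).
by rewrite (daddv_pi_id dUW vU) => /(canRL (addrK _)); rewrite subrr.
Qed.

Let coordsK v : quotv_pi (\sum_i coords v 0 i *: (vbasis W)`_i) = quotv_pi v.
Proof.
under eq_bigr do rewrite mxE.
rewrite -(coord_vbasis (memv_pi _ _ _)); apply/quotv_piP.
have vWU : v \in (W + U)%VS by rewrite addvC addv_complf memvf.
rewrite -{2}(daddv_pi_add dWU vWU) opprD addrA subrr sub0r memvN.
exact: memv_pi.
Qed.

Let coords_congr u v : quotv_pi u = quotv_pi v -> coords u = coords v.
Proof.
move=> /quotv_piP uv; apply/eqP; rewrite -subr_eq0; apply/eqP.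
have -> : coords u - coords v = coords (u - v).
  by apply/rowP=> i; rewrite !mxE !linearB.
by apply/rowP=> i; rewrite !mxE piW_eq0 // linear0.
Qed.

Fact quotv_vect_iso : Vector.axiom (\dim W) quotv.
Proof.
exists (fun x : quotv => coords (repr x)).
  move=> a x y; rewrite -coords_linear; apply: coords_congr.
  by rewrite quotv_pi_is_linear !quotv_reprK.
exists (fun r : 'rV[K]_(\dim W) => quotv_pi (\sum_i r 0 i *: (vbasis W)`_i)).
  by move=> x; rewrite coordsK quotv_reprK.
move=> r; rewrite (coords_congr (quotv_reprK _)).
apply/rowP=> i; rewrite mxE daddv_pi_id //.
  by rewrite coord_sum_free ?(basis_free (vbasisP W)).
by apply: rpred_sum => j _; rewrite rpredZ ?vbasis_mem ?memt_nth.
Qed.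

HB.instance Definition _ := Lmodule_hasFinDim.Build K quotv quotv_vect_iso.

Lemma dim_quotv : \dim {: quotv} = (\dim {:V} - \dim U)%N.
Proof. by rewrite dimvf /= -dimv_compl. Qed.

End QuotientSpace.

Lemma vspace_of_pred (K : fieldType) (V : vectType K) (P : V -> Prop) :
    P 0 -> (forall a u v, P u -> P v -> P (a *: u + v)) ->
  exists U : {vspace V}, forall v, v \in U <-> P v.
Proof.
move=> P0 Plin.
suff H m (U : {vspace V}) : (\dim {:V} - \dim U <= m)%N ->
    (forall v, v \in U -> P v) -> exists U : {vspace V}, forall v, v \in U <-> P v.
  by apply: (H _ 0%VS (leqnn _)) => v; rewrite memv0 => /eqP ->.
elim: m U => [|m IHm] U leUm UP;
  have [PU|nPU] := classic (forall v, P v -> v \in U);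
  do ?by exists U => v; split; auto.
- have Ufull : U = fullv.
    by apply/eqP; rewrite eqEdim subvf /= -subn_eq0 -leqn0.
  by case: nPU => v _; rewrite Ufull memvf.
have [v nPv] := not_all_ex_not _ _ nPU.
have [Pv /negP vU] := imply_to_and _ _ nPv.
apply: (IHm (U + <[v]>)%VS) => [|w /memv_addP[u uU [z /vlineP[c ->] ->]]].
  have ltU : (\dim U < \dim (U + <[v]>))%N.
    rewrite ltnNge; apply: contra vU => le.
    have /eqP -> : U == (U + <[v]>)%VS by rewrite eqEdim addvSl.
    exact: subvP (addvSr _ _) _ (memv_line v).
  rewrite -ltnS (leq_trans _ leUm) // ltn_sub2l //.
  by rewrite (leq_trans ltU) // dimvS // subvf.
by rewrite addrC; apply: Plin => //; apply: UP.
Qed.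

(* The pieces dhomog n.+1 k i of multinomials carry a vector space structure
   only for a successor number of variables, hence n.+1 below. *)
Section Hilbert.

Variables (k : fieldType) (n r : nat) (f : 'I_r -> {mpoly k[n.+1]}).

Definition in_ideal (p : {mpoly k[n.+1]}) : Prop :=
  exists h : 'I_r -> {mpoly k[n.+1]}, p = \sum_j h j * f j.

Lemma in_ideal_part_vspace i :
  exists U : {vspace dhomog n.+1 k i},
    forall p, p \in U <-> in_ideal (mpoly_of_dhomog p).
Proof.
apply: vspace_of_pred => [|a u v [g Eu] [h Ev]].
  by exists (fun=> 0); rewrite big1 // => j _; rewrite mul0r.
exists (fun j => a *: g j + h j).
have -> : mpoly_of_dhomog (a *: u + v) = a *: mpoly_of_dhomog u + mpoly_of_dhomog v.
  exact: linearP.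
rewrite Eu Ev scaler_sumr -big_split /=.
by apply: eq_bigr => j _; rewrite mulrDl scalerAl.
Qed.

Definition ideal_part i : {vspace dhomog n.+1 k i} :=
  proj1_sig (constructive_indefinite_description _ (in_ideal_part_vspace i)).

Lemma ideal_partP i p :
  p \in ideal_part i <-> in_ideal (mpoly_of_dhomog p).
Proof. by rewrite /ideal_part; case: constructive_indefinite_description. Qed.

(* (R/I)_i = R_i / (I :&: R_i); this is the graded piece of R/I when the f j
   are homogeneous. *)
Definition hilbert_function i : nat := \dim {: quotv (ideal_part i)}.

End Hilbert.

(* Formal power series over int, as coefficient sequences. *)
Definition ps_mul (a b : nat -> int) (i : nat) : int :=
  \sum_(j < i.+1) a j * b (i - j)%N.

Definition ps_poly (p : {poly int}) (i : nat) : int := p`_i.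

(* 1 / (1 - t)^n, with 1 / (1 - t) the geometric series *)
Definition ps_geom (n : nat) : nat -> int :=
  iter n (ps_mul (fun=> 1)) (ps_poly 1).

(* (1 - t^d)^r / (1 - t)^n *)
Definition froberg_series (n r d : nat) : nat -> int :=
  ps_mul (ps_poly ((1 - 'X^d) ^+ r)) (ps_geom n).

Lemma ps_geom_coef m n i :
  (i < m)%N -> ps_geom n i = ((\poly_(j < m) 1) ^+ n)`_i.
Proof.
elim: n i => [|n IHn] i lt_im; first by rewrite expr0.
rewrite exprS coefM; apply: eq_bigr => j _; rewrite coef_poly.
have le_ji : (j <= i)%N by rewrite -ltnS.
by rewrite (leq_ltn_trans le_ji lt_im) -IHn // (leq_ltn_trans (leq_subr _ _)).
Qed.

Lemma ps_geomP n :
  ps_mul (ps_poly ((1 - 'X) ^+ n)) (ps_geom n) =1 ps_poly 1.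
Proof.
move=> i; pose g : {poly int} := \poly_(j < i.+1) 1.
transitivity (((1 - 'X) ^+ n * g ^+ n)`_i).
  rewrite coefM; apply: eq_bigr => j _; congr (_ * _).
  by apply: ps_geom_coef; rewrite ltnS leq_subr.
have Eg : (1 - 'X) * g = 1 - 'X^(i.+1).
  rewrite /g poly_def -[1 in RHS](expr1n _ i.+1) subrXX; congr (_ * _).
  by apply: eq_bigr => j _; rewrite expr1n mul1r scale1r.
rewrite -exprMn Eg exprDn /ps_poly coef_sum big_ord_recl /= big1 => [|j _].
  by rewrite addr0 expr1n expr0 mulr1 bin0.
rewrite coefMn expr1n mul1r -scaleN1r exprZn -exprM coefZ coefXn.
by rewrite eqn_leq [X in _ && X](_ : _ = false) ?andbF ?mulr0 ?mul0rn //=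
  /bump /= add1n mulnS leqNgt ltnS leq_addr.
Qed.

Definition ps_trunc (a : nat -> int) (i : nat) : int :=
  if [forall j : 'I_i.+1, 0 < a j] then a i else 0.

(* Main.v *)
(** Below degree [2d] there are no Koszul syzygies, so for every [e < d] one needs
    [r] forms [f_j] of degree [d] for which [(h_j) |-> \sum_j h_j f_j], from
    [r] forms of degree [e] to degree [e + d], has maximal rank.  Maximal rank
    is the nonvanishing of an integer minor, so it suffices to find the [f_j],
    for each [e] separately, over one large finite field [F_q] of suitable
    characteristic, where they are found by counting.

    A functional [phi] on degree [e + d] kills the image iff every [f_j] is
    orthogonal to the rows of the catalecticant of [phi] (rows indexed by the
    monomials of degree [e], columns by those of degree [d]).  Let [T] be the
    set of rows that are not combinations of smaller rows for a monomial order,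
    [s = #|T|], and let [E], [D] be the numbers of monomials of degrees [e] and
    [e + d].  Then [phi] is determined by the [s (E - s)] coefficients
    expressing the other rows, and by its values on the set [T^] of monomials
    whose divisors of degree [e] all lie in [T]; and a proportion at most
    [q^(- r s)] of the families [f] is orthogonal to [phi].  The count closes as
    soon as [#|T^| + s (E - s) <= s D / E], which holds for [n] large because
    [e < d]: see [mon_closure_bound]. *)

Require Import Defs.
From HB Require Import structures.
From mathcomp Require Import all_boot all_order all_algebra all_field.
From mathcomp Require Import zify ring.
From Stdlib Require Import Classical.

Set Implicit Arguments.
Unset Strict Implicit.
Unset Printing Implicit Defensive.

Import Order.TTheory GRing.Theory.
Local Open Scope ring_scope.

(** * Divisors of monomials *)

Section Monomials.
Variable n : nat.
Local Open Scope nat_scope.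

Definition mon (m : nat) : Type := {x : 'X_{1..n < m.+1} | mdeg x == m}.
HB.instance Definition _ m :=
  Finite.copy (mon m) {x : 'X_{1..n < m.+1} | mdeg x == m}.

Definition mnm_of m (x : mon m) : 'X_{1..n} := val (val x).
Coercion mnm_of : mon >-> multinom.

Lemma mnm_of_inj m : injective (@mnm_of m).
Proof. by move=> x y /val_inj /val_inj. Qed.

Lemma mdeg_mon m (x : mon m) : mdeg x = m.
Proof. exact/eqP/(valP x). Qed.

Lemma mon_subproof m (x : 'X_{1..n}) : mdeg x = m -> mdeg x < m.+1.
Proof. by move=> ->. Qed.

Definition to_mon m (x : 'X_{1..n}) (h : mdeg x = m) : mon m :=
  Sub (BMultinom (mon_subproof h)) (introT eqP h).

Lemma to_monE m (x : 'X_{1..n}) (h : mdeg x = m) : to_mon h = x :> 'X_{1..n}.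
Proof. by []. Qed.

Lemma mon_mul_subproof e d (u : mon e) (w : mon d) : mdeg (u + w)%MM = e + d.
Proof. by rewrite mdegD !mdeg_mon. Qed.

Definition mon_mul e d (u : mon e) (w : mon d) : mon (e + d) :=
  to_mon (mon_mul_subproof u w).

Lemma mon_mulE e d (u : mon e) (w : mon d) :
  mon_mul u w = (u + w)%MM :> 'X_{1..n}.
Proof. by []. Qed.

(* The number of ways to reach [u] from [v] by removing [k] variables one at
   a time, the occurrences of a variable being distinguished. *)
Fixpoint paths k (u v : 'X_{1..n}) : nat :=
  if k is k'.+1 then \sum_i v i * paths k' u (v - U_(i))%MM else u == v.

Lemma paths_dvd k (u v : 'X_{1..n}) :
  paths k u v != 0 -> exists2 w, mdeg w = k & v = (u + w)%MM.
Proof.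
elim: k v => [|k IHk] v /=.
  rewrite eqb0 negbK => /eqP ->; exists 0%MM; first exact: mdeg0.
  by rewrite addm0.
rewrite sum_nat_eq0 negb_forall => /existsP[i].
rewrite implyTb muln_eq0 negb_or => /andP[vi /IHk[w dw Ev]].
exists (w + U_(i))%MM; first by rewrite mdegD mdeg1 dw addn1.
by rewrite addmA -Ev submK // lep1mP.
Qed.

Lemma paths_gt0 k (u w : 'X_{1..n}) : mdeg w = k -> 0 < paths k u (u + w)%MM.
Proof.
elim: k w => [|k IHk] w dw /=.
  by have /eqP := dw; rewrite mdeg_eq0 => /eqP ->; rewrite addm0 eqxx.
have [i wi] : exists i, w i != 0.
  apply/existsP; rewrite -negb_forall; apply: contra_eqN dw => /forallP w0.
  by rewrite mdegE big1 // => i _; apply/eqP.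
have lwi : (U_(i) <= w)%MM by rewrite lep1mP.
rewrite (bigD1 i) //= mnmDE ltn_addr // muln_gt0; apply/andP; split; first lia.
rewrite -addmBA //; apply: IHk.
by move: dw; rewrite -{1}(submK lwi) mdegD mdeg1 addn1 => -[].
Qed.

Lemma sum_delta (T : finType) (x : T) (P : pred T) :
  (forall y, P y = (y == x)) -> \sum_y (P y : nat) = 1.
Proof.
move=> E; rewrite (eq_bigr _ (fun y _ => congr1 nat_of_bool (E y))).
by rewrite -big_mkcond big_pred1_eq.
Qed.

(** There are [e + k] occurrences to remove first, then [e + k - 1], and so on down to [e + 1],
    whatever the choices; so the total does not depend on [v]. *)
Lemma sum_paths_col e k (v : 'X_{1..n}) : mdeg v = e + k ->
  \sum_(u : mon e) paths k u v = \prod_(j < k) (e + j.+1).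
Proof.
elim: k v => [|k IHk] v dv /=.
  rewrite addn0 in dv; rewrite big_ord0; apply: (sum_delta (x := to_mon dv)) => y.
  by rewrite -(inj_eq (@mnm_of_inj e)).
rewrite exchange_big /= big_ord_recr /= mulnC -dv mdegE big_distrl /=.
apply: eq_bigr => i _; rewrite -big_distrr /=.
have [->|vi] := eqVneq (v i) 0; first by rewrite !mul0n.
congr (_ * _); apply: IHk.
have lvi : (U_(i) <= v)%MM by rewrite lep1mP.
by move: dv; rewrite -{1}(submK lvi) mdegD mdeg1 addn1 addnS => -[].
Qed.

(** Substitute [v = w + U_(i)]; monomials without the variable [i] have weight zero. *)
Lemma sum_mon_shift m i (G : 'X_{1..n} -> nat) :
  \sum_(v : mon m.+1) v i * G (v - U_(i))%MM = \sum_(w : mon m) (w i).+1 * G w.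
Proof.
have dS (w : mon m) : mdeg (w + U_(i))%MM = m.+1.
  by rewrite mdegD mdeg1 mdeg_mon addn1.
pose h (w : mon m) := to_mon (dS w).
have h_inj : injective h.
  move=> w w' /(congr1 (@mnm_of _)); rewrite !to_monE => /addIm.
  exact: mnm_of_inj.
have v0 (v : mon m.+1) : v \notin h @: [set: mon m] -> v i = 0.
  apply: contraNeq => vi; have lvi : (U_(i) <= v)%MM by rewrite lep1mP.
  have dB : mdeg (v - U_(i))%MM = m.
    by have := mdeg_mon v; rewrite -{1}(submK lvi) mdegD mdeg1 addn1 => -[].
  apply/imsetP; exists (to_mon dB) => //; apply: mnm_of_inj.
  by rewrite to_monE submK.
rewrite (bigID (mem (h @: [set: mon m]))) /= [X in _ + X]big1 ?addn0.
  rewrite big_imset /=; last by move=> w w' _ _; exact: h_inj.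
  rewrite (eq_bigl predT) => [|w]; last by rewrite inE.
  by apply: eq_bigr => w _; rewrite addmK mnmDE mnm1E eqxx addn1.
by move=> v /v0 ->.
Qed.

(** Read upwards: the steps leaving [w] have total weight [\sum_i (w i + 1) = n + mdeg w]. *)
Lemma sum_paths_row e k (u : mon e) :
  \sum_(v : mon (e + k)) paths k u v = \prod_(j < k) (n + e + j).
Proof.
elim: k => [|k IHk] /=.
  rewrite big_ord0; have du : mdeg u = e + 0 by rewrite mdeg_mon addn0.
  apply: (sum_delta (x := to_mon du)) => y.
  by rewrite -(inj_eq (@mnm_of_inj _)) eq_sym.
rewrite addnS exchange_big big_ord_recr /= -IHk mulnC big_distrr /=.
under eq_bigr do rewrite (sum_mon_shift _ _ (paths k u)).
rewrite exchange_big /=; apply: eq_bigr => w _.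
rewrite -big_distrl /=; congr (_ * _).
rewrite (eq_bigr (fun i => w i + 1)); last by move=> i _; rewrite addn1.
by rewrite big_split /= sum1_card card_ord -mdegE mdeg_mon; lia.
Qed.

(** This is [T^]; its complement is the degree [e + d] part of the monomial ideal generated by the
    complement of [T]. *)
Definition mon_closure e d (T : {set mon e}) : {set mon (e + d)} :=
  [set v : mon (e + d) | [forall u : mon e, [forall w : mon d,
     (v == mon_mul u w) ==> (u \in T)]]].

Lemma mon_closureP e d (T : {set mon e}) (v : mon (e + d)) :
  reflect (forall u (w : mon d), v = mon_mul u w -> u \in T)
    (v \in mon_closure d T).
Proof.
rewrite inE; apply: (iffP forallP) => [H u w Ev|H u].
  by have /forallP/(_ w)/implyP := H u; apply; apply/eqP.
by apply/forallP => w; apply/implyP => /eqP; apply: H.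
Qed.

Lemma card_mon_paths e k :
  #|{: mon e}| * \prod_(j < k) (n + e + j)
    = #|{: mon (e + k)}| * \prod_(j < k) (e + j.+1).
Proof.
rewrite -!sum_nat_const.
under eq_bigr => u _ do rewrite -(sum_paths_row k u).
rewrite exchange_big /=; apply: eq_bigr => v _.
by rewrite (sum_paths_col (mdeg_mon v)).
Qed.

(* Picking a pair of degree-[e] divisors of a random monomial [v] of degree
   [e + d], each through [paths], every pair [(u, u')] is reached from at
   least [#|mon (d - e)|] monomials [v]; hence, for [n] large, a random [v] has
   a divisor on each side of [T] with large enough probability. *)
Lemma mon_closure_bound e d (T : {set mon e}) (c := \prod_(j < d) (e + j.+1)) :
  e <= d -> c ^ 2 <= #|{: mon (d - e)}| ->
  #|{: mon e}| * (#|mon_closure d T| + #|T| * #|~: T|)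
    <= #|T| * #|{: mon (e + d)}|.
Proof.
move=> led hc.
pose p (u : mon e) (v : mon (e + d)) := paths d u v.
pose pT v := \sum_(u in T) p u v; pose pC v := \sum_(u in ~: T) p u v.
have pTC v : pT v + pC v = c.
  rewrite /c -(sum_paths_col (mdeg_mon v)) [RHS](bigID (mem T)) /=.
  by congr (_ + _); apply: eq_bigl => u; rewrite inE.
have c_gt0 : 0 < c by rewrite prodn_gt0 // => j; rewrite addnS.
pose R := \prod_(j < d) (n + e + j).
have sumT : \sum_v pT v = #|T| * R.
  rewrite exchange_big /= -sum_nat_const; apply: eq_bigr => u _.
  exact: sum_paths_row.
have pC0 v : v \in mon_closure d T -> pC v = 0.
  move/mon_closureP=> vT; apply: big1 => u; rewrite inE; apply: contraNeq.
  case/paths_dvd => w dw Ev; apply: (vT u (to_mon dw)).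
  exact: mnm_of_inj.
(* On [T^] one has [pC = 0] and [pT = c], so [c * pT = c ^ 2]; elsewhere [pC <= c] suffices. *)
have upper : \sum_v pT v * pC v + c ^ 2 * #|mon_closure d T| <= c * (#|T| * R).
  rewrite -sumT big_distrr /= (bigID (mem (mon_closure d T))) /=.
  rewrite [X in _ <= X](bigID (mem (mon_closure d T))) /=.
  rewrite big1 => [|v vT]; last by rewrite pC0 ?muln0.
  rewrite add0n addnC leq_add //; last first.
    by apply: leq_sum => v _; rewrite mulnC leq_mul // -(pTC v) leq_addl.
  rewrite mulnC -sum_nat_const leq_sum // => v vT.
  by rewrite -(pTC v) pC0 // addn0.
(* The products of [u], [u'] and a monomial [w] of degree [d - e] are distinct multiples of both. *)
have pair (u u' : mon e) : #|{: mon (d - e)}| <= \sum_v p u v * p u' v.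
  have dv (w : mon (d - e)) : mdeg (u + (u' + w))%MM = e + d.
    by rewrite !mdegD !mdeg_mon subnKC.
  pose h w := to_mon (dv w).
  have h_inj : injective h.
    move=> w w' /(congr1 (@mnm_of _)); rewrite !to_monE => /addmI /addmI.
    exact: mnm_of_inj.
  rewrite -(card_imset _ h_inj) -sum1_card big_mkcond /=.
  apply: leq_sum => v _; case: ifP => // /imsetP[w _ ->].
  rewrite muln_gt0 /p to_monE paths_gt0 ?mdegD ?mdeg_mon ?subnKC //.
  by rewrite addmA (addmC u) -addmA paths_gt0 ?mdegD ?mdeg_mon ?subnKC.
have lower : #|T| * #|~: T| * #|{: mon (d - e)}| <= \sum_v pT v * pC v.
  rewrite -mulnA -sum_nat_const.
  under [X in _ <= X]eq_bigr do rewrite big_distrl /=.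
  rewrite exchange_big /=; apply: leq_sum => u uT.
  under [X in _ <= X]eq_bigr do rewrite big_distrr /=.
  by rewrite exchange_big /= -sum_nat_const; apply: leq_sum => u' _.
have {}lower : c ^ 2 * (#|T| * #|~: T|) <= \sum_v pT v * pC v.
  by apply: leq_trans lower; rewrite mulnC leq_mul.
have cR : c * (#|mon_closure d T| + #|T| * #|~: T|) <= #|T| * R.
  rewrite -(leq_pmul2l c_gt0) mulnA mulnn mulnDr.
  by rewrite (leq_trans _ upper) // addnC leq_add2r.
rewrite -(leq_pmul2l c_gt0) mulnCA (leq_trans (leq_mul (leqnn _) cR)) //.
by rewrite mulnCA card_mon_paths mulnA mulnC.
Qed.
End Monomials.

(** * Standard rows and counting over finite fields *)

Section StandardRows.
Variables (F : fieldType) (I : finType) (disp : Order.disp_t).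
Variables (K : orderType disp) (key : I -> K) (N : nat) (row_of : I -> 'rV[F]_N).
Hypothesis key_inj : injective key.

Definition span_below (P : pred I) u : 'M[F]_N :=
  (\sum_(i | P i && (key i < key u)%O) <<row_of i>>)%MS.

Definition std_rows : {set I} :=
  [set u | ~~ (row_of u <= span_below predT u)%MS].

(** Induction on the number of smaller keys: a non-standard row below [u] is a combination of rows
    below itself, hence of standard ones. *)
Lemma span_below_std u : (span_below predT u <= span_below (mem std_rows) u)%MS.
Proof.
have [k] := ubnP #|[set i | (key i < key u)%O]|; elim: k u => // k IHk u ltk.
apply/sumsmx_subP => i /= lt_iu; rewrite genmxE.
have [iT|] := boolP (i \in std_rows).
  by apply: (sumsmx_sup i); [apply/andP | rewrite genmxE].
rewrite inE negbK => /submx_trans; apply.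
have lti : (#|[set j | (key j < key i)%O]| < k)%N.
  rewrite ltnS in ltk; apply: leq_trans ltk; apply: proper_card.
  apply/properP; split.
    by apply/subsetP => j; rewrite !inE => /lt_trans; apply.
  by exists i; rewrite !inE ?ltxx.
apply: submx_trans (IHk i lti) _.
apply/sumsmx_subP => j /andP[jT lt_ji]; apply: (sumsmx_sup j) => //.
by apply/andP; rewrite (lt_trans lt_ji).
Qed.

Lemma std_rows_relation u : u \notin std_rows ->
  exists2 c : I -> F,
    forall i, c i != 0 -> (i \in std_rows) && (key i < key u)%O &
    row_of u = \sum_i c i *: row_of i.
Proof.
rewrite inE negbK => /submx_trans/(_ (span_below_std u)) /sub_sumsmxP[x Ex].
have /fin_all_exists[c Ec] i : exists a, x i *m <<row_of i>>%MS = a *: row_of i.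
  by apply/sub_rVP; rewrite (submx_trans (submxMl _ _)) ?genmxE.
exists (fun i => if (i \in std_rows) && (key i < key u)%O then c i else 0).
  by move=> i; case: ifP => //; rewrite eqxx.
rewrite Ex big_mkcond /=; apply: eq_bigr => i _; case: ifP => _ //.
by rewrite scale0r.
Qed.

(** In a set of standard rows, the one of largest key lies outside the span of the others, so adding
    it raises the rank. *)
Lemma card_std_rows : (#|std_rows| <= \rank (\sum_i <<row_of i>>)%MS)%N.
Proof.
suff H (S : {set I}) : S \subset std_rows ->
    (#|S| <= \rank (\sum_(i in S) <<row_of i>>)%MS)%N.
  apply: leq_trans (H _ (subxx _)) (mxrankS _).
  by apply/sumsmx_subP => i _; rewrite (sumsmx_sup i).
have [k] := ubnP #|S|; elim: k S => // k IHk S ltk sST.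
have [->|[u0 u0S]] := set_0Vmem S; first by rewrite cards0.
pose u := [arg max_(i > u0 in S) key i]%O.
have [uS umax] : u \in S /\ forall i, i \in S -> (key i <= key u)%O.
  by rewrite /u; case: Order.TotalTheory.arg_maxP.
rewrite (cardsD1 u) uS add1n.
have := IHk (S :\ u); rewrite (cardsD1 u) uS ltnS in ltk.
move=> /(_ ltk (subset_trans (subsetDl _ _) sST)) /leq_ltn_trans; apply.
apply: rank_ltmx; rewrite ltmxE; apply/andP; split.
  apply/sumsmx_subP => i; rewrite !inE => /andP[_ iS].
  exact: (sumsmx_sup i).
apply/negP => sub.
have := subsetP sST u uS; rewrite inE => /negP; apply.
have : (row_of u <= \sum_(i in S) <<row_of i>>)%MS.
  by rewrite (sumsmx_sup u) ?genmxE.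
move/submx_trans/(_ sub)/submx_trans; apply.
apply/sumsmx_subP => i; rewrite !inE => /andP[ne_iu iS].
by rewrite (sumsmx_sup i) //= lt_neqAle (inj_eq key_inj) ne_iu umax.
Qed.
End StandardRows.

Lemma card_row_space (F : finFieldType) r m N (M : 'M[F]_(m, N)) :
  #|[set X : 'M[F]_(r, N) | (X <= M)%MS]| = (#|F| ^ (r * \rank M))%N.
Proof.
rewrite -(card_mx F r (\rank M)) -cardsT.
rewrite -(card_imset _ (row_free_inj (row_base_free M) (m := r))).
apply: eq_card => X; rewrite inE -(eq_row_base M).
apply/submxP/imsetP => [[Y ->]|[Y _ ->]]; by exists Y.
Qed.

Lemma card_mulmx0 (F : finFieldType) r m N (B : 'M[F]_(N, m)) :
  #|[set X : 'M[F]_(r, N) | X *m B == 0]| = (#|F| ^ (r * (N - \rank B)))%N.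
Proof.
rewrite -mxrank_ker -card_row_space; apply: eq_card => X.
by rewrite !inE; apply/eqP/idP => /sub_kermxP.
Qed.

(** * Catalecticants of functionals *)

Section Catalecticant.
Variables (n e d r : nat).
Local Notation mon := (mon n).
Local Notation "'dimM' m" := #|{: mon m}| (at level 10, m at level 8).

(* The matrix of [(h_j) |-> \sum_j h_j f_j] from [r] forms of degree [e] to
   forms of degree [e + d], in the monomial bases; row [j] of [f] lists the
   coefficients of [f_j]. *)
Definition mul_matrix (K : pzSemiRingType) (f : 'M[K]_(r, dimM d)) :
    'M[K]_(#|{: 'I_r * mon e}|, dimM (e + d)) :=
  \matrix_(i, k) \sum_j f (enum_val i).1 j *
    (mon_mul (enum_val i).2 (enum_val j) == enum_val k)%:R.

Variable F : fieldType.
Implicit Types phi : 'rV[F]_(dimM (e + d)).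

Definition coef_at phi (v : mon (e + d)) := phi 0 (enum_rank v).

Definition cat_row phi (u : mon e) : 'rV[F]_(dimM d) :=
  \row_j coef_at phi (mon_mul u (enum_val j)).

Definition cat_matrix phi : 'M[F]_(dimM e, dimM d) :=
  \matrix_i cat_row phi (enum_val i).

(** The entry indexed by [(j, u)] is, on both sides, the value of [phi] on [u f_j]. *)
Lemma mul_matrix_perp phi (f : 'M[F]_(r, dimM d)) :
  (phi *m (mul_matrix f)^T == 0) = (f *m (cat_matrix phi)^T == 0).
Proof.
have E (j : 'I_r) (u : mon e) :
    (phi *m (mul_matrix f)^T) 0 (enum_rank (j, u)) =
    (f *m (cat_matrix phi)^T) j (enum_rank u).
  rewrite !mxE; under eq_bigr do rewrite !mxE enum_rankK big_distrr /=.
  rewrite exchange_big /=; apply: eq_bigr => i _; rewrite !mxE enum_rankK.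
  rewrite (bigD1 (enum_rank (mon_mul u (enum_val i)))) //= enum_rankK eqxx.
  rewrite big1 ?addr0 ?mulr1 1?mulrC // => k ne.
  have /negbTE -> : mon_mul u (enum_val i) != enum_val k.
    by apply: contraNneq ne => ->; rewrite enum_valK.
  by rewrite !mulr0.
apply/eqP/eqP => H.
  apply/matrixP => j i; rewrite -(enum_valK i) -E H.
  by rewrite !mxE.
apply/rowP => i; rewrite -(enum_valK i).
by case: (enum_val i) => j u; rewrite E H !mxE.
Qed.

Definition std_mons phi : {set mon e} := std_rows (@mnm_of n e) (cat_row phi).

Lemma card_std phi : (#|std_mons phi| <= \rank (cat_matrix phi))%N.
Proof.
apply: leq_trans (card_std_rows (cat_row phi) (@mnm_of_inj n e)) (mxrankS _).
apply/sumsmx_subP => u _; rewrite genmxE.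
have -> : cat_row phi u = row (enum_rank u) (cat_matrix phi).
  by rewrite rowK enum_rankK.
exact: row_sub.
Qed.

Lemma std_relation phi u : u \notin std_mons phi ->
  exists2 c : mon e -> F,
    forall i : mon e, c i != 0 ->
      (i \in std_mons phi) && (mnm_of i < mnm_of u)%O &
    forall w : mon d, coef_at phi (mon_mul u w) =
      \sum_i c i * coef_at phi (mon_mul i w).
Proof.
case/std_rows_relation => c Hc Er; exists c => // w.
move/rowP/(_ (enum_rank w)): Er; rewrite mxE enum_rankK => ->.
by rewrite summxE; apply: eq_bigr => i _; rewrite !mxE enum_rankK.
Qed.

(* A monomial off [mon_closure d T] has a divisor of degree [e] outside [T], so
   its coefficient is determined by those of smaller monomials. *)
Lemma std_determined (T : {set mon e}) (c : mon e -> mon e -> F) phi psi :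
    (forall u i : mon e, c u i != 0 -> (mnm_of i < mnm_of u)%O) ->
    (forall u (w : mon d), u \notin T ->
       coef_at phi (mon_mul u w) = \sum_i c u i * coef_at phi (mon_mul i w)) ->
    (forall u (w : mon d), u \notin T ->
       coef_at psi (mon_mul u w) = \sum_i c u i * coef_at psi (mon_mul i w)) ->
    {in mon_closure d T, coef_at phi =1 coef_at psi} ->
  phi = psi.
Proof.
move=> Hc Ephi Epsi H.
suff E v : coef_at phi v = coef_at psi v.
  by apply/rowP => i; have := E (enum_val i); rewrite /coef_at enum_valK.
move: {2}(mnm_of v) (erefl (mnm_of v)) => m.
elim/(@ltmwf n): m v => m IHm v Ev.
have [vT|] := boolP (v \in mon_closure d T); first exact: H.
rewrite inE negb_forall => /existsP[u]; rewrite negb_forall => /existsP[w].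
rewrite negb_imply => /andP[/eqP Evuw uT].
rewrite Evuw Ephi // Epsi //; apply: eq_bigr => i _.
have [->|ci] := eqVneq (c u i) 0; first by rewrite !mul0r.
congr (_ * _); apply: (IHm _ _ _ erefl).
by rewrite -Ev Evuw !mon_mulE ltmc_add2l; apply: Hc.
Qed.

End Catalecticant.

Section FiniteCount.
Variables (n e d r : nat) (F : finFieldType).
Local Notation mon := (mon n).
Local Notation "'dimM' m" := #|{: mon m}| (at level 10, m at level 8).

(** A functional is encoded by relations, supported on [D], expressing its rows off [T] through
    those in [T], and by its values on [T^]; [std_determined] makes the encoding injective. *)
Lemma card_std_fibre (T : {set mon e}) :
  (#|[set phi : 'rV[F]_(dimM (e + d)) | std_mons phi == T]|
    <= #|F| ^ (#|T| * #|~: T| + #|mon_closure d T|))%N.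
Proof.
pose D := [set x : mon e * mon e | (x.1 \in ~: T) && (x.2 \in T)].
have cardD : #|D| = (#|T| * #|~: T|)%N.
  by rewrite mulnC -cardsX; apply: eq_card => x; rewrite !inE.
pose good (phi : 'rV[F]_(dimM (e + d))) (c : {ffun mon e * mon e -> F}) :=
  [&& c \in pffun_on 0 (mem D) predT,
     [forall x : mon e * mon e, (c x != 0) ==> (mnm_of x.2 < mnm_of x.1)%O] &
     [forall u : mon e, [forall w : mon d, (u \notin T) ==>
       (coef_at phi (mon_mul u w)
         == \sum_i c (u, i) * coef_at phi (mon_mul i w))]]].
(* By [goodC], the default is never taken on the fibre. *)
pose C phi := odflt [ffun=> 0] [pick c | good phi c].
have goodC phi : std_mons phi == T -> good phi (C phi).
  move/eqP=> ET; rewrite /C; case: pickP => //= nogood; exfalso.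
  have /fin_all_exists2[c Hc Ec] (u : mon e) : exists2 c : mon e -> F,
    forall i, c i != 0 -> [&& u \notin T, i \in T & (mnm_of i < mnm_of u)%O] &
    u \notin T -> forall w : mon d, coef_at phi (mon_mul u w) =
      \sum_i c i * coef_at phi (mon_mul i w).
    have [uT|uT] := boolP (u \in T).
      by exists (fun=> 0) => // i; rewrite eqxx.
    have := uT; rewrite -{1}ET => /std_relation[c Hc Ec].
    by exists c => // i /Hc; rewrite ET.
  have /negP[] := nogood [ffun x => c x.1 x.2]; apply/and3P; split.
  - apply/pffun_onP; split=> //; apply/subsetP => x.
    by rewrite inE ffunE => /Hc /and3P[? ? _]; rewrite !inE; apply/andP.
  - by apply/forallP => x; apply/implyP; rewrite ffunE => /Hc /and3P[].
  apply/forallP => u; apply/forallP => w; apply/implyP => uT.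
  by rewrite Ec //; apply/eqP; apply: eq_bigr => i _; rewrite ffunE.
pose res (phi : 'rV[F]_(dimM (e + d))) : {ffun mon (e + d) -> F} :=
  [ffun v => if v \in mon_closure d T then coef_at phi v else 0].
pose h phi := (C phi, res phi).
set S := [set phi | _].
have h_inj : {in S &, injective h}.
  move=> phi psi; rewrite !inE => /goodC + /goodC + [EC Er].
  rewrite -EC => /and3P[_ /forallP lt /forallP Ephi] /and3P[_ _ /forallP Epsi].
  apply: (@std_determined _ _ _ _ T (fun u i => C phi (u, i))).
  - by move=> u i ci; have /implyP := lt (u, i); apply.
  - by move=> u w uT; have /forallP/(_ w)/implyP/(_ uT)/eqP := Ephi u.
  - by move=> u w uT; have /forallP/(_ w)/implyP/(_ uT)/eqP := Epsi u.
  by move=> v vT; move/ffunP/(_ v): Er; rewrite !ffunE vT.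
rewrite -(card_in_imset h_inj).
apply: (@leq_trans #|setX [set c | c \in pffun_on (0 : F) (mem D) predT]
    [set g | g \in pffun_on (0 : F) (mem (mon_closure d T)) predT]|).
  apply: subset_leq_card; apply/subsetP => _ /imsetP[phi + ->].
  rewrite in_set => /goodC /andP[cP _]; rewrite in_setX !in_set cP.
  apply/pffun_onP; split=> //.
  by apply/subsetP => v; rewrite inE ffunE; case: ifP => //; rewrite eqxx.
have card_supp (J : finType) (A : {set J}) :
    #|[set g : {ffun J -> F} | g \in pffun_on 0 (mem A) predT]| = (#|F| ^ #|A|)%N.
  by rewrite cardsE card_pffun_on.
by rewrite cardsX !card_supp cardD expnD.
Qed.

(** Write [q] for [#|F|]. The truncated difference [m] is the least possible corank, which treats
    injectivity and surjectivity at once. If no [f] attained it, at least [q ^ m.+1] functionals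
    would kill the image of each [f], while the sets [T] allow at most
    [2 ^ dimM e * q ^ (r * dimM d + m)] pairs in all; this contradicts [2 ^ dimM e < q]. *)
Lemma max_rank_finite (c := (\prod_(j < d) (e + j.+1))%N) :
    (e <= d)%N -> (c ^ 2 <= dimM (d - e))%N -> (2 ^ dimM e < #|F|)%N ->
  exists f : 'M[F]_(r, dimM d),
    (dimM (e + d) <= \rank (mul_matrix e f) + (dimM (e + d) - r * dimM e))%N.
Proof.
move=> led hc ltF; apply/existsP; apply: contraT.
rewrite negb_exists => /forallP H.
set m := (_ - _)%N in H.
have F_gt0 : (0 < #|F|)%N by apply: leq_trans ltF; rewrite ltnS.
pose pairs := (\sum_(f : 'M[F]_(r, dimM d))
  #|[set phi : 'rV[F]_(dimM (e + d)) | (phi *m (mul_matrix e f)^T == 0)%R]|)%N.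
have pairsE : pairs = (\sum_(phi : 'rV[F]_(dimM (e + d)))
    #|[set f : 'M[F]_(r, dimM d) | (f *m (cat_matrix phi)^T == 0)%R]|)%N.
  under [RHS]eq_bigr do rewrite -sum1_card.
  rewrite (exchange_big_dep predT) //=; apply: eq_bigr => f _.
  rewrite -sum1_card; apply: eq_bigl => phi.
  by rewrite !inE mul_matrix_perp.
have lower : (#|F| ^ (r * dimM d) * #|F| ^ m.+1 <= pairs)%N.
  rewrite -[X in (X * _ <= _)%N]card_mx -sum_nat_const.
  apply: leq_sum => f _; rewrite card_mulmx0 mul1n mxrank_tr.
  by rewrite leq_pexp2l //; have := H f; rewrite -ltnNge; lia.
have upper : (pairs <= 2 ^ dimM e * #|F| ^ (r * dimM d + m))%N.
  rewrite pairsE (partition_big (@std_mons n e d F) predT) //=.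
  have -> : (2 ^ dimM e = #|{: {set mon e}}|)%N.
    by rewrite -[X in (2 ^ X)%N]cardsT -card_powerset powersetT cardsT.
  rewrite -sum_nat_const; apply: leq_sum => T _.
  pose S := [set phi : 'rV[F]_(dimM (e + d)) | std_mons phi == T].
  apply: (@leq_trans (\sum_(phi in S) #|F| ^ (r * (dimM d - #|T|)))%N).
    rewrite [X in (_ <= X)%N](eq_bigl (fun phi => std_mons phi == T)) => [|phi];
      last by rewrite inE.
    apply: leq_sum => phi /eqP <-; rewrite card_mulmx0 mxrank_tr.
    by rewrite leq_pexp2l // leq_mul2l leq_sub2l ?orbT // card_std.
  rewrite sum_nat_const.
  have [->|[phi phiS]] := set_0Vmem S; first by rewrite cards0.
  have leT : (#|T| <= dimM d)%N.
    have := phiS; rewrite inE => /eqP <-.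
    exact: leq_trans (card_std phi) (rank_leq_col _).
  apply: leq_trans (leq_mul (card_std_fibre T) (leqnn _)) _.
  rewrite -expnD leq_pexp2l //.
  have := max_card (mem (mon_closure d T)).
  have := mon_closure_bound T led hc.
  have := cardsC T; have : (dimM (e + d) <= m + r * dimM e)%N by rewrite /m; lia.
  set E := dimM e; set D := dimM (e + d); set N := dimM d in leT *.
  set s := #|T| in leT *; set s' := #|~: T|; set cl := #|mon_closure d T|.
  clearbody E D N m s s' cl; clear -leT.
  move=> leD Ess' bound clD.
  have [E0|E_gt0] := posnP E; first by nia.
  (* This follows from [E * (cl + s * s') <= s * D <= s * (m + r * E)] and [s <= E]. *)
  suff : (s * s' + cl <= m + r * s)%N by nia.
  rewrite -(leq_pmul2l E_gt0) addnC (leq_trans bound) //.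
  by nia.
have := leq_trans lower upper.
rewrite -expnD addnS expnS leq_mul2r expn_eq0 eqn0Ngt F_gt0 /=.
by move=> le; move: ltF; rewrite ltnNge le.
Qed.
End FiniteCount.

(** * From a finite field to an infinite one *)

Section Minors.
Variables (F : fieldType) (m n : nat).

Lemma exists_minor (A : 'M[F]_(m, n)) :
  exists (g : 'I_(\rank A) -> 'I_m) (h : 'I_(\rank A) -> 'I_n),
    \det (mxsub g h A) != 0.
Proof.
pose B := rowsub (maxrankfun A) A.
have fB : row_full B^T.
  by rewrite /row_full mxrank_tr; apply: maxrowsub_free.
exists (maxrankfun A), (fullrankfun fB).
suff -> : mxsub (maxrankfun A) (fullrankfun fB) A
    = (rowsub (fullrankfun fB) B^T)^T.
  by rewrite det_tr -unitfE -unitmxE fullrowsub_unit.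
by apply/matrixP => i j; rewrite !mxE.
Qed.

Lemma minor_rank p (A : 'M[F]_(m, n)) (g : 'I_p -> 'I_m) (h : 'I_p -> 'I_n) :
  \det (mxsub g h A) != 0 -> (p <= \rank A)%N.
Proof.
rewrite -unitfE -unitmxE -row_full_unit => /eqP <-.
rewrite mxsubrc (leq_trans (mxrankS (rowsub_sub _ _))) //.
by rewrite -mxrank_tr trmx_mxsub -(mxrank_tr A) mxrankS // rowsub_sub.
Qed.
End Minors.

Section InfiniteField.
Variables (k : fieldType) (k_inf : infinite_field k).

Lemma infinite_uniq m : exists2 s : seq k, uniq s & size s = m.
Proof.
elim: m => [|m [s us <-]]; first by exists [::].
by have [x xs] := k_inf s; exists (x :: s); rewrite //= xs.
Qed.

Lemma poly_nonroot (p : {poly k}) : p != 0 -> exists x, p.[x] != 0.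
Proof.
move=> p0; have [s us szs] := infinite_uniq (size p).
have /allPn[x _ px] : ~~ all (root p) s.
  by apply/negP => rs; have := max_poly_roots p0 rs us; rewrite szs ltnn.
by exists x.
Qed.

Definition mnm_low n (m : 'X_{1..n.+1}) : 'X_{1..n} :=
  [multinom m (widen_ord (leqnSn n) i) | i < n].

Lemma coef_muni n (p : {mpoly k[n.+1]}) (m : 'X_{1..n.+1}) :
  ((muni p)`_(m ord_max))@_(mnm_low m) = p@_m.
Proof.
rewrite muniE [in RHS](mpolyE p) coef_sum !raddf_sum /=; apply: eq_bigr => m' _.
rewrite coefZ coefXn mcoeffZ mcoeffX.
have -> : (m' == m) = (mnm_low m' == mnm_low m) && (m ord_max == m' ord_max).
  apply/eqP/andP => [-> //|[/eqP/mnmP El /eqP Em]].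
  apply/mnmP => i; case: (unliftP ord_max i) => [j|] -> //.
  have -> : lift ord_max j = widen_ord (leqnSn n) j.
    by apply: val_inj; rewrite /= /bump leqNgt ltn_ord.
  by have := El j; rewrite !mnmE.
case: eqP => _; rewrite ?andbT ?andbF ?mulr1 ?mulr0 ?mcoeff0 //.
by rewrite mcoeffZ mcoeffX.
Qed.

Lemma evaluation_last n (p : {mpoly k[n.+1]}) v x :
  (map_poly (meval v) (muni p)).[x] =
  p.@[fun i => if insub (val i) is Some j then v j else x].
Proof.
rewrite muniE mevalE raddf_sum horner_sum; apply: eq_bigr => m _.
rewrite big_ord_recr /= insubN ?ltnn // -mul_polyC rmorphM /= map_polyC map_polyXn.
rewrite hornerM hornerXn hornerC /= mevalZ mevalX mulrA; congr (_ * _ * _).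
apply: eq_bigr => i _; rewrite insubT //= => lt.
by rewrite mnmE; congr (v _ ^+ _); apply: val_inj.
Qed.

(** View [p] as a polynomial in the last variable: by induction some point keeps one of its
    coefficients nonzero, and the resulting univariate polynomial has only finitely many roots. *)
Lemma mpoly_nonroot n (p : {mpoly k[n]}) : p != 0 -> exists v, p.@[v] != 0.
Proof.
elim: n p => [|n IHn] p p0.
  exists (fun=> 0); move: p0; rewrite (nvar0_mpolyC p) mevalC.
  by apply: contraNneq => ->.
have [m pm] : exists m, p@_m != 0.
  apply/not_all_not_ex => H; move/eqP: p0; apply; apply/mpolyP => m.
  by rewrite mcoeff0; apply/eqP/negPn/negP/H.
have /IHn[v pv] : (muni p)`_(m ord_max) != 0.
  by apply: contraNneq pm => E; rewrite -coef_muni E mcoeff0.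
have /poly_nonroot[x] : map_poly (meval v) (muni p) != 0.
  by apply: contraNneq pv => E; rewrite -coef_map E coef0.
rewrite evaluation_last.
by exists (fun i => if insub (val i) is Some j then v j else x).
Qed.
End InfiniteField.

Section Transfer.
Variables (n e d r : nat).
Local Notation Nd := #|{: mon n d}|.
Local Notation var := {: 'I_r * 'I_Nd}.

Lemma map_mul_matrix (K L : pzRingType) (g : {rmorphism K -> L}) (f : 'M[K]_(r, Nd)) :
  map_mx g (mul_matrix e f) = mul_matrix e (map_mx g f).
Proof.
apply/matrixP => i j; rewrite !mxE rmorph_sum; apply: eq_bigr => l _.
by rewrite rmorphM rmorph_nat !mxE.
Qed.

(** One indeterminate per coefficient, over the integers, so that the same minor specialises to both
    [F] and [k]. *)
Definition generic_forms : 'M[{mpoly int[#|var|]}]_(r, Nd) :=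
  \matrix_(j, i) 'X_(enum_rank (j, i)).

Definition eval_forms (K : comNzRingType) (f : 'M[K]_(r, Nd)) (i : 'I_#|var|) : K :=
  f (enum_val i).1 (enum_val i).2.

Lemma eval_generic_minor (K : comNzRingType) (f : 'M[K]_(r, Nd)) p
    (g : 'I_p -> 'I_#|{: 'I_r * mon n e}|) (h : 'I_p -> 'I_#|{: mon n (e + d)}|) :
  (map_mpoly intr (\det (mxsub g h (mul_matrix e generic_forms)))).@[eval_forms f]
  = \det (mxsub g h (mul_matrix e f)).
Proof.
rewrite -!det_map_mx /= !map_mxsub !map_mul_matrix.
congr (\det (mxsub g h (mul_matrix e _))); apply/matrixP => j i.
by rewrite !mxE /= map_mpolyX mevalXU /eval_forms enum_rankK.
Qed.

(* A nonzero minor over [F] is the value of an integer polynomial that is not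
   zero modulo the characteristic of [F]. *)
Lemma rank_transfer (F k : fieldType) (f : 'M[F]_(r, Nd)) :
    (forall c : int, c%:~R = 0 :> k -> c%:~R = 0 :> F) ->
  exists2 P : {mpoly k[#|var|]}, P != 0 &
    forall f' : 'M[k]_(r, Nd), P.@[eval_forms f'] != 0 ->
      (\rank (mul_matrix e f) <= \rank (mul_matrix e f'))%N.
Proof.
move=> kF; have [g [h dA]] := exists_minor (mul_matrix e f).
pose Q := \det (mxsub g h (mul_matrix e generic_forms)).
exists (map_mpoly intr Q); last first.
  by move=> f'; rewrite eval_generic_minor; apply: minor_rank.
rewrite -eval_generic_minor -/Q in dA; apply: contraNneq dA => Q0.
(* If the integer coefficients of [Q] all vanish in [k], they vanish in [F], and so does the
   minor. *)
suff -> : map_mpoly (intr : int -> F) Q = 0 by rewrite meval0.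
apply/mpolyP => m; rewrite mcoeff_map_mpoly mcoeff0; apply: kF.
by rewrite -(mcoeff_map_mpoly (intr : {rmorphism int -> k})) Q0 mcoeff0.
Qed.
End Transfer.

Lemma exists_field_char (k : fieldType) (N : nat) :
  exists2 F : finFieldType, (N < #|F|)%N &
    forall c : int, c%:~R = 0 :> k -> c%:~R = 0 :> F.
Proof.
have [p p_pr kp] : exists2 p : nat, prime p &
    forall c : int, c%:~R = 0 :> k -> (p %| `|c|)%N.
  have intr0 (c : int) : c%:~R = 0 :> k -> `|c|%:R = 0 :> k.
    case: c => m /= => [//|]; rewrite NegzE rmorphN => /eqP.
    by rewrite oppr_eq0 => /eqP.
  have [[p pk]|nochar] := classic (exists p, p \in [pchar k]).
    exists p; first exact: pcharf_prime pk.
    by move=> c /intr0 /eqP; rewrite (dvdn_pcharf pk).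
  have /pcharf0P char0 : [pchar k] =i pred0.
    by move=> p; apply/negP => pk; apply: nochar; exists p.
  (* In characteristic zero only the integer 0 vanishes in [k], so any prime serves. *)
  by exists 2 => // c /intr0 /eqP; rewrite char0 absz_eq0 => /eqP ->.
have [F pF cardF] := pPrimePowerField p_pr (ltn0Sn N).
exists F.
  by rewrite cardF (leq_trans (ltnSn _)) // ltnW // ltn_expl // prime_gt1.
move=> c /kp; rewrite (dvdn_pcharf pF) => /eqP.
by case: c => m //= pm; rewrite NegzE mulrNz -pmulrn pm oppr0.
Qed.

(** * The Hilbert function as a corank *)

Lemma card_mon n m : #|{: mon n.+1 m}| = 'C(m + n, m).
Proof.
rewrite -(mpoly.size_basis n m) cardE -(size_map (@mnm_of n.+1 m)).
apply/perm_size/uniq_perm.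
- by rewrite (map_inj_uniq (@mnm_of_inj _ _)) enum_uniq.
- exact: uniq_basis.
move=> x; rewrite -basis_cover; apply/mapP/eqP => [[y _ ->]|dx].
  exact: mdeg_mon.
by exists (to_mon dx); rewrite ?mem_enum.
Qed.

Lemma mcoeffMX_notdvd n (R : nzRingType) (p : {mpoly R[n]}) (w v : 'X_{1..n}) :
  ~~ (w <= v)%MM -> (p * 'X_[w])@_v = 0.
Proof.
move=> nwv; rewrite (mpolyE p) big_distrl raddf_sum /= big1 // => m _.
rewrite -scalerAl -mpolyXD mcoeffZ mcoeffX.
case: eqP => [E|_]; last by rewrite mulr0.
by rewrite -E lem_addl in nwv.
Qed.

Lemma mcoeffMX_mon n (R : nzRingType) e d (p : {mpoly R[n]}) (w : mon n d)
    (v : mon n (e + d)) :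
  (p * 'X_[w])@_v = \sum_(u : mon n e) p@_u * (mon_mul u w == v)%:R.
Proof.
have [wv|nwv] := boolP (mnm_of w <= v)%MM; last first.
  rewrite mcoeffMX_notdvd // big1 // => u _.
  case: eqP => [E|_]; last by rewrite mulr0.
  by rewrite -E mon_mulE lem_addl in nwv.
have du : mdeg (v - w)%MM = e.
  have := congr1 (@mdeg n) (submK wv); rewrite mdegD !mdeg_mon.
  exact: addIn.
have Ev : mon_mul (to_mon du) w = v.
  by apply: mnm_of_inj; rewrite mon_mulE to_monE submK.
rewrite (bigD1 (to_mon du)) //= Ev eqxx mulr1 big1 => [|u ne].
  by rewrite addr0 to_monE -[in LHS](submK wv) addmC mcoeffMX.
case: eqP => [E|_]; last by rewrite mulr0.
case/eqP: ne; apply: mnm_of_inj; apply: (@addIm _ w).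
by rewrite to_monE submK // -mon_mulE E.
Qed.

Section HilbertRank.
Variables (k : fieldType) (n d r : nat).
Local Notation Nd := #|{: mon n.+1 d}|.
Variable c : 'M[k]_(r, Nd).

Definition form_of (j : 'I_r) : {mpoly k[n.+1]} :=
  \sum_i c j i *: 'X_[mnm_of (enum_val i)].

Lemma form_of_homog j : form_of j \is d.-homog.
Proof.
apply: rpred_sum => i _; apply: rpredZ.
by rewrite dhomogX; apply/eqP/mdeg_mon.
Qed.

(** Every term of an element of the ideal is divisible by a monomial of degree [d], so the ideal is
    zero in degree [i]. *)
Lemma hilbert_function_lt i : (i < d)%N ->
  hilbert_function form_of i = #|{: mon n.+1 i}|.
Proof.
move=> lt_id; rewrite /hilbert_function dim_quotv dimvf /= card_mon.
suff -> : ideal_part form_of i = 0%VS by rewrite dimv0 subn0.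
apply/eqP; rewrite -subv0; apply/subvP => p /ideal_partP[h Ep].
rewrite memv0; apply/eqP/val_inj => /=; apply/mpolyP => m; rewrite mcoeff0.
have [dm|dm] := eqVneq (mdeg m) i; last first.
  exact: (dhomog_nemf_coeff (dhomog_is_dhomog p)).
rewrite Ep raddf_sum big1 // => j _ /=.
rewrite /form_of big_distrr raddf_sum big1 // => l _ /=.
rewrite -scalerAr mcoeffZ mcoeffMX_notdvd ?mulr0 //.
apply/negP => /submK /(congr1 (@mdeg _)); rewrite mdegD mdeg_mon dm => E.
by rewrite -E ltnNge leq_addl in lt_id.
Qed.

Section Degree.
Variable e : nat.
Local Notation V := (dhomog n.+1 k (e + d)).
Local Notation D := #|{: mon n.+1 (e + d)}|.

Definition coefs (p : {mpoly k[n.+1]}) : 'rV[k]_D :=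
  \row_i p@_(mnm_of (enum_val i)).

Lemma coefs_linear : linear coefs.
Proof. by move=> a p q; apply/rowP => i; rewrite !mxE mcoeffD mcoeffZ. Qed.
HB.instance Definition _ := GRing.isLinear.Build k {mpoly k[n.+1]} 'rV[k]_D _
  coefs coefs_linear.

Lemma coefs_inj : {in (e + d).-homog &, injective coefs}.
Proof.
move=> p q hp hq /rowP E; apply/mpolyP => m.
have [dm|dm] := eqVneq (mdeg m) (e + d)%N; last first.
  by rewrite !(dhomog_nemf_coeff _ dm).
by have := E (enum_rank (to_mon dm)); rewrite !mxE enum_rankK.
Qed.

Lemma of_coefs_subproof (x : 'rV[k]_D) :
  \sum_i x 0 i *: 'X_[mnm_of (enum_val i)] \is (e + d).-homog.
Proof.
apply: rpred_sum => i _; apply: rpredZ.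
by rewrite dhomogX; apply/eqP/mdeg_mon.
Qed.

Definition of_coefs x : V := DHomog (of_coefs_subproof x).

Lemma of_coefsK x : coefs (of_coefs x) = x.
Proof.
apply/rowP => i; rewrite mxE /= raddf_sum (bigD1 i) //= mcoeffZ mcoeffX eqxx mulr1.
rewrite big1 ?addr0 // => l ne; rewrite mcoeffZ mcoeffX.
case: eqP => [/mnm_of_inj /enum_val_inj E|_]; last by rewrite mulr0.
by rewrite E eqxx in ne.
Qed.

(** The forms have degree [d], so only the degree [e] coefficients of the multipliers reach degree
    [e + d]. *)
Lemma coefs_ideal (h : 'I_r -> {mpoly k[n.+1]}) :
  coefs (\sum_j h j * form_of j) =
  (\row_i (h (enum_val i).1)@_(mnm_of (enum_val i).2)) *m mul_matrix e c.
Proof.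
apply/rowP => l; rewrite !mxE raddf_sum /=.
rewrite [RHS](reindex_onto (@enum_rank _) (@enum_val _ _)) /=; last first.
  by move=> i _; rewrite enum_valK.
rewrite [RHS](eq_bigl predT) => [|x]; last by rewrite enum_rankK eqxx.
under [RHS]eq_bigr do rewrite !mxE enum_rankK.
rewrite -(pair_bigA _ (fun (j : 'I_r) (u : mon n.+1 e) => (h j)@_(mnm_of u) *
  \sum_i c j i * (mon_mul u (enum_val i) == enum_val l)%:R)) /=.
apply: eq_bigr => j _; rewrite /form_of big_distrr raddf_sum /=.
under eq_bigr => i _ do rewrite -scalerAr mcoeffZ mcoeffMX_mon big_distrr /=.
rewrite exchange_big; apply: eq_bigr => u _; rewrite big_distrr /=.
by apply: eq_bigr => i _; rewrite mulrCA.
Qed.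

Lemma ideal_part_coefs (p : V) :
  (p \in ideal_part form_of (e + d)) = (coefs p <= mul_matrix e c)%MS.
Proof.
apply/idP/submxP => [/ideal_partP[h ->]|[y Ey]].
  by eexists; apply: coefs_ideal.
apply/ideal_partP.
exists (fun j => \sum_(u : mon n.+1 e) y 0 (enum_rank (j, u)) *: 'X_[mnm_of u]).
apply: coefs_inj.
- exact: dhomog_is_dhomog.
- apply: rpred_sum => j _; apply: dhomogM; last exact: form_of_homog.
  by apply: rpred_sum => u _; apply: rpredZ; rewrite dhomogX; apply/eqP/mdeg_mon.
rewrite Ey coefs_ideal; congr (_ *m _); apply/rowP => i; rewrite mxE.
case E: (enum_val i) => [j u] /=; rewrite raddf_sum (bigD1 u) //=.
rewrite mcoeffZ mcoeffX eqxx mulr1 big1 => [|u' ne].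
  by rewrite addr0 -E enum_valK.
rewrite mcoeffZ mcoeffX; case: eqP => [/mnm_of_inj E'|_]; last by rewrite mulr0.
by rewrite E' eqxx in ne.
Qed.

(** Through [coefs] the ideal part becomes the row space, and a row base pulls back to a basis
    [X]. *)
Lemma dim_ideal_part : \dim (ideal_part form_of (e + d)) = \rank (mul_matrix e c).
Proof.
set A := mul_matrix e c; pose B := row_base A.
pose X := [tuple of_coefs (row i B) | i < \rank A].
apply: (@size_basis _ _ _ _ X); apply/andP; split.
  rewrite eqEsubv; apply/andP; split.
    apply/span_subvP => p /mapP[i _ ->].
    by rewrite ideal_part_coefs of_coefsK (submx_trans (row_sub _ _)) ?eq_row_base.
  apply/subvP => p; rewrite ideal_part_coefs => pA.
  have /submxP[y Ey] : (coefs p <= B)%MS by rewrite eq_row_base.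
  suff -> : p = \sum_(i < \rank A) y 0 i *: X`_i.
    by apply: rpred_sum => i _; rewrite rpredZ // memv_span // mem_nth // size_tuple.
  apply: val_inj; apply: coefs_inj; rewrite ?dhomog_is_dhomog //.
  rewrite Ey mulmx_sum_row raddf_sum linear_sum /=; apply: eq_bigr => i _.
  by rewrite (nth_map i) ?size_enum_ord // !linearZ /= of_coefsK nth_ord_enum.
apply/freeP => a E i.
have : (\row_i a i) *m B = coefs (mpoly_of_dhomog (\sum_i a i *: X`_i)).
  rewrite mulmx_sum_row !linear_sum /=; apply: eq_bigr => l _; rewrite mxE.
  by rewrite !linearZ /= (nth_map i) ?size_enum_ord // of_coefsK nth_ord_enum.
rewrite E !linear0.
move/(congr1 (mulmxr (pinvmx B))); rewrite /= mul0mx.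
rewrite mulmxKp ?row_base_free // => /rowP/(_ i).
by rewrite !mxE.
Qed.

Lemma hilbert_function_rank :
  hilbert_function form_of (e + d) = (D - \rank (mul_matrix e c))%N.
Proof.
rewrite /hilbert_function dim_quotv dim_ideal_part dimvf.
by congr (_ - _)%N; rewrite card_mon.
Qed.
End Degree.
End HilbertRank.

(** * Coefficients of the series *)

(** Multiplying by [1 / (1 - t)] takes partial sums, which Pascal's rule evaluates. *)
Lemma ps_geomE n i : ps_geom n.+1 i = #|{: mon n.+1 i}|%:Z.
Proof.
elim: n i => [|n IHn] i; rewrite card_mon.
  rewrite addn0 binn /ps_geom /= /ps_mul big_ord_recr /= subnn /ps_poly coef1 eqxx.
  rewrite mulr1 big1 ?add0r // => j _.
  by rewrite coef1 subn_eq0 leqNgt ltn_ord mulr0.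
have -> : ps_geom n.+2 i = \sum_(j < i.+1) ps_geom n.+1 j.
  rewrite [LHS]/(ps_mul (fun=> 1) (ps_geom n.+1) i) (reindex_inj rev_ord_inj) /=.
  by apply: eq_bigr => j _; rewrite mul1r subSS subKn // -ltnS.
elim: i => [|i IHi].
  by rewrite big_ord1 IHn card_mon !bin0.
transitivity (\sum_(j < i.+1) ps_geom n.+1 j + ps_geom n.+1 i.+1).
  by rewrite big_ord_recr.
rewrite IHi IHn !card_mon -PoszD addSnnS [in RHS]addSn binS.
by rewrite addnC.
Qed.

(** From the third on, the terms of the binomial expansion have degree at least [2 d]. *)
Lemma coef_exp_1subXn r d j : (0 < d)%N -> (j < 2 * d)%N ->
  ((1 - 'X^d) ^+ r : {poly int})`_j = (j == 0%N)%:R - (j == d)%:R * r%:Z.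
Proof.
move=> d_gt0; elim: r j => [|r IHr] j ltj.
  by rewrite expr0 coef1 mulr0 subr0.
rewrite exprSr mulrBr mulr1 coefB coefMXn IHr //.
case: ltnP => le_dj.
  by rewrite (ltn_eqF le_dj) mulr0n !mul0r !subr0.
rewrite IHr; last by lia.
have -> : (j - d == d)%N = false by lia.
have -> : (j - d == 0)%N = (j == d) by lia.
by case: (j == d); rewrite ?mulr0n ?mul0r ?mul1r ?subr0 //; lia.
Qed.

#[local] Arguments ps_geom : simpl never.

Lemma froberg_series_lt n r d i : (i < d)%N ->
  froberg_series n.+1 r d i = #|{: mon n.+1 i}|%:Z.
Proof.
move=> lt_id; have d_gt0 : (0 < d)%N by lia.
rewrite /froberg_series /ps_mul big_ord_recl /= subn0 ps_geomE.
rewrite /ps_poly coef_exp_1subXn //; last by lia.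
rewrite (ltn_eqF d_gt0) eqxx mulr0n mul0r subr0 mul1r big1 ?addr0 // => j _.
rewrite coef_exp_1subXn //; last by have := ltn_ord j; rewrite /= /bump /=; lia.
rewrite /bump /= add1n; have -> : (j.+1 == d) = false by have := ltn_ord j; lia.
by rewrite !mulr0n !mul0r.
Qed.

Lemma froberg_series_ge n r d e : (e < d)%N ->
  froberg_series n.+1 r d (e + d) =
  #|{: mon n.+1 (e + d)}|%:Z - r%:Z * #|{: mon n.+1 e}|%:Z.
Proof.
move=> lt_ed; have d_gt0 : (0 < d)%N by lia.
have ltd : (d < (e + d).+1)%N by lia.
rewrite /froberg_series /ps_mul big_ord_recl /= subn0 ps_geomE.
rewrite /ps_poly coef_exp_1subXn //; last by lia.
rewrite (ltn_eqF d_gt0) eqxx mulr0n mul0r subr0 mul1r; congr (_ + _).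
(* The head of the sum has been split off, so the index [d - 1] stands for the exponent [d]. *)
have d1 : (d.-1 < e + d)%N by lia.
rewrite (bigD1 (Ordinal d1)) //= big1 => [|j ne].
  rewrite addr0 /bump /= add1n prednK // coef_exp_1subXn //; last by lia.
  by rewrite (gtn_eqF d_gt0) eqxx mulr0n sub0r mul1r addnK ps_geomE mulNr.
rewrite coef_exp_1subXn //; last by have := ltn_ord j; rewrite /= /bump /=; lia.
rewrite /bump /= add1n; have -> : (j.+1 == d) = false.
  by apply: contraNF ne => /eqP E; apply/eqP/val_inj => /=; lia.
by rewrite !mulr0n !mul0r.
Qed.

(** Passing from degree [x] to [x + 1] multiplies the number of monomials by
    [(x + n + 1) / (x + 1)], which does not increase with [x]. Hence, below degree [2 d], a
    non-positive coefficient of the series is followed only by non-positive ones, in agreement with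
    the truncation. *)
Lemma card_mon_ratio n r d e e' : (e' <= e)%N ->
  (#|{: mon n.+1 (e' + d)}| <= r * #|{: mon n.+1 e'}|)%N ->
  (#|{: mon n.+1 (e + d)}| <= r * #|{: mon n.+1 e}|)%N.
Proof.
move=> /subnK <-; elim: (e - e')%N => // m IHm /IHm.
rewrite addSn; set x := (m + e')%N; rewrite addSn !card_mon !addSn.
have := mul_bin_diag (x + d + n).+1 (x + d); have := mul_bin_diag (x + n).+1 x.
rewrite /=; set A := 'C(_, x.+1); set B := 'C(_, (x + d).+1).
set A' := 'C(_, x); set B' := 'C(_, (x + d)%N).
clearbody A A' B B' x => E1 E2 le.
have h1 : (x.+1 * (x + d + n).+1 <= (x + d).+1 * (x + n).+1)%N by nia.
rewrite -(@leq_pmul2l (x.+1 * (x + d).+1)) // -mulnA -E2 mulnA.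
apply: leq_trans (leq_mul h1 le) _.
by rewrite -!mulnA (mulnCA _ r) E1; apply: eq_leq; ring.
Qed.

(** * Forms of maximal rank over an infinite field, and conclusion *)

Lemma card_mon_ge n m : (0 < m)%N -> (n.+1 <= #|{: mon n.+1 m}|)%N.
Proof.
move=> m_gt0; rewrite card_mon -bin_sub ?leq_addr // addKn.
by rewrite (leq_trans _ (leq_bin2l n (_ : n.+1 <= m + n)%N)) ?binSn //; lia.
Qed.

(** Each [e] yields a nonzero polynomial [P e] in the coefficients of the forms whose non-roots have
    maximal rank; a non-root of the product serves all [e < d] at once. *)
Lemma max_rank_forms (k : fieldType) (hk : infinite_field k) d n r :
    (((2 * d) ^ d) ^ 2 <= n.+1)%N ->
  exists c : 'M[k]_(r, #|{: mon n.+1 d}|), forall e, (e < d)%N ->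
    (#|{: mon n.+1 (e + d)}| - \rank (mul_matrix e c)
      = #|{: mon n.+1 (e + d)}| - r * #|{: mon n.+1 e}|)%N.
Proof.
move=> hn; pose D e := #|{: mon n.+1 (e + d)}|.
pose Nv := #|{: 'I_r * 'I_#|{: mon n.+1 d}|}|.
have [P P0 HP] : exists2 P : 'I_d -> {mpoly k[Nv]}, forall e, P e != 0 &
    forall (e : 'I_d) (c : 'M[k]_(r, #|{: mon n.+1 d}|)),
      (P e).@[eval_forms c] != 0 ->
      (D e <= \rank (mul_matrix e c) + (D e - r * #|{: mon n.+1 e}|))%N.
  suff /fin_all_exists2 H (e : 'I_d) : exists2 P : {mpoly k[Nv]}, P != 0 &
      forall c : 'M[k]_(r, #|{: mon n.+1 d}|), P.@[eval_forms c] != 0 ->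
      (D e <= \rank (mul_matrix e c) + (D e - r * #|{: mon n.+1 e}|))%N.
    by case: H => P HP0 HP; exists P.
  have [F cardF kF] := exists_field_char k (2 ^ #|{: mon n.+1 e}|).
  have led : (e <= d)%N by rewrite ltnW.
  have hc : ((\prod_(j < d) (e + j.+1)) ^ 2 <= #|{: mon n.+1 (d - e)}|)%N.
    (* As [d - e > 0] there are at least [n + 1] monomials, and each of the [d] factors [e + j + 1]
       is at most [2 d]. *)
    rewrite (leq_trans _ (card_mon_ge n _)) ?subn_gt0 //.
    rewrite (leq_trans _ hn) // leq_exp2r // -[X in (_ <= _ ^ X)%N](card_ord d).
    rewrite -prod_nat_const leq_prod // => j _.
    by have := ltn_ord e; have := ltn_ord j; lia.
  have [f rkf] := max_rank_finite r led hc cardF.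
  have [P P0 HP] := rank_transfer e f kF.
  exists P => // c /HP le; apply: leq_trans rkf _.
  by rewrite leq_add2r.
have /(mpoly_nonroot hk)[v] : \prod_e P e != 0 by apply/prodf_neq0.
rewrite rmorph_prod /= => /prodf_neq0 Pv.
exists (\matrix_(j, i) v (enum_rank (j, i))) => e lt_ed.
set c := \matrix_(j, i) _.
have := HP (Ordinal lt_ed) c; rewrite (@meval_eq _ _ _ v); last first.
  by move=> i; rewrite /eval_forms mxE -surjective_pairing enum_valK.
rewrite Pv // => /(_ isT) /=; rewrite -/(D e).
(* The number of rows bounds the rank, which gives the opposite inequality. *)
have : (\rank (mul_matrix e c) <= r * #|{: mon n.+1 e}|)%N.
  by rewrite (leq_trans (rank_leq_row _)) // card_prod card_ord.
by set rho := \rank _; set E := #|{: mon n.+1 e}|; clearbody rho E; lia.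
Qed.

Theorem theorem2 (k : fieldType) (hk : infinite_field k) (d : nat)
    (hd : (1 < d)%N) :
  exists N : nat, forall n : nat, (N <= n.+1)%N ->
  forall r : nat, (0 < r)%N ->
  exists f : 'I_r -> {mpoly k[n.+1]},
    (forall j, f j \is d.-homog) /\
    (forall i : nat, (i <= 2 * d - 1)%N ->
       (hilbert_function f i)%:Z = ps_trunc (froberg_series n.+1 r d) i).
Proof.
exists (((2 * d) ^ d) ^ 2)%N => n hn r _.
have [c rk_c] := max_rank_forms hk r hn.
exists (form_of c); split=> [j|i le_i]; first exact: form_of_homog.
have card_gt0 m : (0 < #|{: mon n.+1 m}|)%N by rewrite card_mon bin_gt0 leq_addr.
have [lt_id|le_di] := ltnP i d.
  rewrite hilbert_function_lt // /ps_trunc froberg_series_lt //.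
  rewrite ifT //; apply/forallP => j; rewrite froberg_series_lt ?ltz_nat //.
  by rewrite (leq_ltn_trans _ lt_id) // -ltnS.
rewrite -(subnK le_di) in le_i *; move: (i - d)%N le_i => e le_e {i le_di}.
have lt_ed : (e < d)%N by lia.
rewrite hilbert_function_rank rk_c //.
rewrite /ps_trunc; case: forallP => [pos|npos].
  have := pos ord_max; rewrite /= froberg_series_ge // => pos_e.
  by rewrite subzn; last by lia.
(* The first [d] coefficients are positive, so a non-positive one occurs at some [j] with
   [d <= j <= e + d]; [card_mon_ratio] carries it up to [e + d], where the truncated difference is
   then 0. *)
suff -> : (#|{: mon n.+1 (e + d)}| - r * #|{: mon n.+1 e}| = 0)%N by [].
apply/eqP; rewrite subn_eq0.
have [j] : exists j : 'I_(e + d).+1, ~~ (0 < froberg_series n.+1 r d j).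
  by apply/existsP; rewrite -negb_forall; apply/forallP.
have [lt_jd|le_dj] := ltnP j d.
  by rewrite froberg_series_lt // ltz_nat card_gt0.
rewrite -(subnK le_dj) froberg_series_ge; last by have := ltn_ord j; lia.
move=> nonpos; apply: (@card_mon_ratio n r d e (j - d)).
  by have := ltn_ord j; lia.
by lia.
Qed.
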